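(* Let $a>0$, $M_0>0$, and let $\rho(x)=|x|+a$ on $\mathbb{R}$. Up to the reflection $x\mapsto -x$, the interval of weighted mass $M_0$ with least weighted perimeter among all intervals of weighted mass $M_0$ has one end at the origin and the other at $$\beta=-a+\sqrt{a^2+2M_0}.$$ Its weighted perimeter is $P=a+\sqrt{a^2+2M_0}$.
   Context: For a density $\rho$ on $\mathbb{R}$, an interval $[\alpha,\beta]$ has weighted perimeter $\rho(\alpha)+\rho(\beta)$ and weighted mass $\int_\alpha^\beta\rho(x)\,dx$. *)

(* Defs.v *)
From Stdlib Require Import Reals.
From Coquelicot Require Import Coquelicot.
Open Scope R_scope.

Definition weighted_perimeter (rho : R -> R) (alpha beta : R) : R :=
  rho alpha + rho beta.

(* [RInt] is Coquelicot's total Riemann integral; it has its usual meaning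
   as soon as [rho] is continuous on [[alpha, beta]]. *)
Definition weighted_mass (rho : R -> R) (alpha beta : R) : R :=
  RInt rho alpha beta.

Definition interval_of_mass (rho : R -> R) (M alpha beta : R) : Prop :=
  alpha <= beta /\ weighted_mass rho alpha beta = M.

Definition least_perimeter_interval (rho : R -> R) (M alpha beta : R) : Prop :=
  interval_of_mass rho M alpha beta /\
  forall alpha' beta' : R,
    interval_of_mass rho M alpha' beta' ->
    weighted_perimeter rho alpha beta <= weighted_perimeter rho alpha' beta'.

(* Main.v *)
Require Import Defs.
From Stdlib Require Import Reals Lra.
From Coquelicot Require Import Coquelicot.
Open Scope R_scope.

(** Write [s] and [t] for the densities at the ends of an interval and
    [r = sqrt (a ^ 2 + 2 * M)].  Since [x |-> x * Rabs x / 2 + a * x] is a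
    primitive of the density, and equals [(rho x ^ 2 - a ^ 2) / 2] up to the sign
    of [x], prescribing the mass [M] amounts to a quadratic relation between
    [s] and [t], both at least [a]:

    - if the origin is not interior to the interval, the larger of [s] and [t]
      has square equal to that of the smaller plus [2 * M]; both are then
      smallest when the smaller one is [a];
    - if the interval contains the origin, [s ^ 2 + t ^ 2 = a ^ 2 + r ^ 2].  The
      sum of squares being prescribed, [s + t] increases with the product [s * t],
      and [(s * t) ^ 2 - (a * r) ^ 2 = (s ^ 2 - a ^ 2) * (t ^ 2 - a ^ 2) >= 0].

    So the perimeter is at least [a + r] ([perimeter_lower_bound]), with
    equality only if one end has density [a], that is, lies at the origin; the
    mass then determines the other end ([mass_from_origin]).  Conversely both
    such intervals have mass [M] and perimeter [a + r]. *)

(** The single estimate [Rabs (F (x + h) - F x - F' x * h) <= h ^ 2 / 2] treats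
    the corner of the density at the origin like every other point. *)
Lemma is_derive_primitive_Rabs_plus (a x : R) :
  is_derive (fun y => y * Rabs y / 2 + a * y) x (Rabs x + a).
Proof.
  apply is_derive_Reals; intros eps Heps.
  exists (mkposreal eps Heps); intros h h0 Hh; simpl in Hh.
  assert (E : Rabs ((x + h) * Rabs (x + h) - x * Rabs x - 2 * h * Rabs x)
              <= h * h) by (split_Rabs; nra).
  replace (((x + h) * Rabs (x + h) / 2 + a * (x + h) -
            (x * Rabs x / 2 + a * x)) / h - (Rabs x + a))
    with (((x + h) * Rabs (x + h) - x * Rabs x - 2 * h * Rabs x) / (2 * h))
    by (field; exact h0).
  rewrite Rabs_div by lra.
  assert (P : 0 < Rabs (2 * h)) by (apply Rabs_pos_lt; lra).
  apply Rmult_lt_reg_r with (Rabs (2 * h)); [exact P|].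
  unfold Rdiv; rewrite Rmult_assoc, Rinv_l, Rmult_1_r by lra.
  apply Rle_lt_trans with (1 := E).
  rewrite Rabs_mult, (Rabs_pos_eq 2) by lra.
  assert (0 < Rabs h) by (apply Rabs_pos_lt; exact h0).
  replace (h * h) with (Rabs h * Rabs h) by (split_Rabs; ring).
  nra.
Qed.

Lemma weighted_mass_Rabs_plus (a alpha beta : R) :
  weighted_mass (fun x => Rabs x + a) alpha beta =
  (beta * Rabs beta / 2 + a * beta) - (alpha * Rabs alpha / 2 + a * alpha).
Proof.
  unfold weighted_mass; apply is_RInt_unique.
  apply (is_RInt_derive (fun y => y * Rabs y / 2 + a * y) (fun x => Rabs x + a)).
  - intros x _; apply is_derive_primitive_Rabs_plus.
  - intros x _; apply (continuous_plus Rabs (fun _ => a)).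
    + apply continuous_Rabs.
    + apply continuous_const.
Qed.

(** Used for an interval on one side of the origin, [s] being the density at the
    end nearer to it: [t] increases with [s] and equals [r] at [s = a]. *)
Lemma sum_ge_of_sqr_diff (a r s t : R) :
  0 < a -> a < r -> a <= s -> 0 <= t ->
  t ^ 2 - s ^ 2 = r ^ 2 - a ^ 2 ->
  a + r <= s + t /\ (s + t = a + r -> s = a).
Proof.
  intros ha hr hs ht E.
  assert (r <= t) by nra.
  split; [lra | intros; lra].
Qed.

(** Used for an interval around the origin: [s + t] is
    concave along the arc of the circle [s ^ 2 + t ^ 2 = a ^ 2 + r ^ 2] in the
    positive quadrant, so it is least at the ends of the part of that arc cut
    out by [s = a] and [t = a]. *)
Lemma sum_ge_of_sqr_sum (a r s t : R) :
  0 < a -> a < r -> a <= s -> a <= t ->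
  s ^ 2 + t ^ 2 = a ^ 2 + r ^ 2 ->
  a + r <= s + t /\ (s + t = a + r -> s = a \/ t = a).
Proof.
  intros ha hr hs ht E.
  assert (Hprod : (s * t) ^ 2 - (a * r) ^ 2 = (s ^ 2 - a ^ 2) * (t ^ 2 - a ^ 2)).
  { rewrite !Rpow_mult_distr.
    replace (r ^ 2) with (s ^ 2 + t ^ 2 - a ^ 2) by lra; ring. }
  assert (0 <= s ^ 2 - a ^ 2) by nra.
  assert (0 <= t ^ 2 - a ^ 2) by nra.
  assert (0 < s * t) by nra.
  assert (0 < a * r) by nra.
  assert (a * r <= s * t) by nra.
  split; [nra|].
  intros Hsum.
  (* Equal sums and equal sums of squares force equal products. *)
  assert (Hst : s * t = a * r).
  { assert ((s + t) ^ 2 = (a + r) ^ 2) by (rewrite Hsum; reflexivity). lra. }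
  rewrite Hst in Hprod.
  assert (Hz : (s ^ 2 - a ^ 2) * (t ^ 2 - a ^ 2) = 0) by lra.
  apply Rmult_integral in Hz; destruct Hz; [left | right]; nra.
Qed.

Lemma perimeter_lower_bound (a M alpha beta : R) :
  0 < a -> 0 < M ->
  interval_of_mass (fun x => Rabs x + a) M alpha beta ->
  a + sqrt (a ^ 2 + 2 * M) <= weighted_perimeter (fun x => Rabs x + a) alpha beta /\
  (weighted_perimeter (fun x => Rabs x + a) alpha beta = a + sqrt (a ^ 2 + 2 * M) ->
   alpha = 0 \/ beta = 0).
Proof.
  intros ha hM [Hle Hm]; rewrite weighted_mass_Rabs_plus in Hm.
  unfold weighted_perimeter.
  assert (Hr2 : sqrt (a ^ 2 + 2 * M) ^ 2 = a ^ 2 + 2 * M)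
    by (apply pow2_sqrt; nra).
  pose proof (sqrt_pos (a ^ 2 + 2 * M)) as Hr0.
  set (r := sqrt (a ^ 2 + 2 * M)) in *.
  assert (Har : a < r) by nra.
  destruct (Rle_lt_dec 0 alpha) as [Ha | Ha].
  - rewrite (Rabs_pos_eq alpha), (Rabs_pos_eq beta) in * by lra.
    destruct (sum_ge_of_sqr_diff a r (alpha + a) (beta + a)); lra.
  - destruct (Rle_lt_dec beta 0) as [Hb | Hb].
    + rewrite (Rabs_left1 alpha), (Rabs_left1 beta) in * by lra.
      destruct (sum_ge_of_sqr_diff a r (- beta + a) (- alpha + a)); lra.
    + rewrite (Rabs_left1 alpha), (Rabs_pos_eq beta) in * by lra.
      destruct (sum_ge_of_sqr_sum a r (- alpha + a) (beta + a)); lra.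
Qed.

(** Completing the square in the mass of an interval of length [x] with one end
    at the origin gives [(x + a) ^ 2 = a ^ 2 + 2 * M]. *)
Lemma mass_from_origin (a M x : R) :
  0 < a -> 0 < M -> 0 <= x ->
  x * x / 2 + a * x = M <-> x = - a + sqrt (a ^ 2 + 2 * M).
Proof.
  intros ha hM hx; split.
  - intros E.
    replace (a ^ 2 + 2 * M) with ((x + a) ^ 2) by (rewrite <- E; field).
    rewrite sqrt_pow2 by lra; ring.
  - intros E.
    assert (Hr2 : sqrt (a ^ 2 + 2 * M) ^ 2 = a ^ 2 + 2 * M)
      by (apply pow2_sqrt; nra).
    replace (sqrt (a ^ 2 + 2 * M)) with (x + a) in Hr2 by lra.
    lra.
Qed.

Theorem lemma4 (a M0 : R) (ha : 0 < a) (hM0 : 0 < M0) :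
  let rho := fun x : R => Rabs x + a in
  let b := - a + sqrt (a ^ 2 + 2 * M0) in
  (forall alpha beta : R,
      least_perimeter_interval rho M0 alpha beta <->
      (alpha = 0 /\ beta = b) \/ (alpha = - b /\ beta = 0)) /\
  (forall alpha beta : R,
      least_perimeter_interval rho M0 alpha beta ->
      weighted_perimeter rho alpha beta = a + sqrt (a ^ 2 + 2 * M0)).
Proof.
  intros rho b.
  assert (Hb : 0 <= b).
  { unfold b.
    assert (a <= sqrt (a ^ 2 + 2 * M0)); [|lra].
    rewrite <- (sqrt_pow2 a) at 1 by lra.
    apply sqrt_le_1_alt; lra. }
  pose proof (proj2 (mass_from_origin a M0 b ha hM0 Hb) eq_refl) as Hmass.
  assert (Hends : forall alpha beta,
             (alpha = 0 /\ beta = b) \/ (alpha = - b /\ beta = 0) ->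
             interval_of_mass rho M0 alpha beta /\
             weighted_perimeter rho alpha beta = a + sqrt (a ^ 2 + 2 * M0)).
  { intros alpha beta [[-> ->] | [-> ->]];
      unfold interval_of_mass, weighted_perimeter, rho;
      rewrite weighted_mass_Rabs_plus, ?Rabs_Ropp, Rabs_R0, (Rabs_pos_eq b Hb);
      (split; [split; lra | unfold b; ring]). }
  assert (Hper : forall alpha beta, least_perimeter_interval rho M0 alpha beta ->
             weighted_perimeter rho alpha beta = a + sqrt (a ^ 2 + 2 * M0)).
  { intros alpha beta [Hi Hmin].
    destruct (Hends 0 b) as [Hi0 HP0]; [left; split; reflexivity|].
    apply Rle_antisym.
    - rewrite <- HP0; apply Hmin, Hi0.
    - apply (perimeter_lower_bound a M0 alpha beta ha hM0 Hi). }
  split; [|exact Hper].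
  intros alpha beta; split.
  - intros Hl.
    pose proof (Hper _ _ Hl) as HP; destruct Hl as [Hi _].
    destruct (perimeter_lower_bound a M0 alpha beta ha hM0 Hi) as [_ Heq].
    specialize (Heq HP).
    destruct Hi as [Hle Hm]; unfold rho in Hm; rewrite weighted_mass_Rabs_plus in Hm.
    destruct Heq as [-> | ->]; [left | right]; split; try reflexivity.
    + apply mass_from_origin; [exact ha | exact hM0 | exact Hle |].
      rewrite Rabs_R0, (Rabs_pos_eq beta Hle) in Hm; lra.
    + rewrite Rabs_R0, (Rabs_left1 alpha Hle) in Hm.
      assert (- alpha = b); [|lra].
      apply mass_from_origin; lra.
  - intros H; destruct (Hends _ _ H) as [Hi HP].
    split; [exact Hi|].
    intros alpha' beta' Hi'; rewrite HP.
    apply (perimeter_lower_bound a M0 alpha' beta' ha hM0 Hi').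
Qed.
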